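(* Let $n\ge 2$ be even and let $P$ be a dense $2$-regular $(n,n,1,n(n-1)/2)$ PDA, whose associated graph is the complete graph $K_n$. Let $\{M_1,\dots,M_{n-1}\}$ be a 1-factorization of $K_n$, with the $i$-th 1-factor written as $M_i=\{e(s_{ij}): j\in\{1,\dots,n/2\}\}$. For $z\in\{1,2,\dots,n-2\}$, let $P_z$ be the array obtained from $P$ by replacing all entries equal to $s_{ij}$ by $\ast$, for all $1\le i\le z$ and $j\in\{1,\dots,n/2\}$. Then $P_z$ is a $2$-regular $(n,n,z+1,n(n-z-1)/2)$ PDA.
   Context: Notation: $[n]=\{0,1,\dots,n-1\}$. For positive integers $K,f$, a nonnegative integer $Z$ and a finite set $\mathcal{S}$ of integers, a $(K,f,Z,\mathcal{S})$ placement delivery array (PDA) is an $f\times K$ array $P=[p_{j,k}]$, $j\in[f]$, $k\in[K]$, with entries in $\mathcal{S}\cup\{\ast\}$ such that: (C1) $\ast$ appears exactly $Z$ times in each column; (C2) each $s\in\mathcal{S}$ occurs at least once; (C3, Blackburn property) if two distinct cells $(j_1,k_1)$, $(j_2,k_2)$ contain the same integer then $p_{j_1,k_2}=p_{j_2,k_1}=\ast$. The PDA is $g$-regular if each integer of $\mathcal{S}$ occurs exactly $g$ times. When a number $S$ is written in place of the set, it means that the integer set has exactly $S$ elements. Dense $2$-regular PDA: an $n\times n$ array obtained by setting all diagonal (or all anti-diagonal) cells to $\ast$, filling the $n(n-1)/2$ cells on one side of the diagonal (resp. anti-diagonal) with distinct integers, and filling the other side by reflection across the diagonal (resp. anti-diagonal).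 Associated graph: for a $2$-regular $(n,n,Z,\mathcal{S})$ PDA in which $s$ occurs in columns $j_1(s)$ and $j_2(s)$, $G(P)$ has vertex set $\{0,\dots,n-1\}$ and, for each $s\in\mathcal{S}$, an edge $e(s)$ joining $j_1(s)$ and $j_2(s)$. A 1-factor is a set of pairwise disjoint edges covering all vertices; a 1-factorization is a partition of the edge set into 1-factors. *)

(* Defs.v *)
From HB Require Import structures.
From mathcomp Require Import all_boot all_order all_algebra.
From mathcomp Require Import finmap.

Set Implicit Arguments.
Unset Strict Implicit.
Unset Printing Implicit Defensive.

(* An array with entries in S \cup {*} is a matrix over [option int]: [Some s]
   is the integer entry s and [None] is the star.  Rows are indexed by 'I_f and
   columns by 'I_K, so the array is f x K although K comes first in the
   parameter list (K, f, Z, S). *)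

Definition is_pda (K f Z : nat) (S : {fset int}) (P : 'M[option int]_(f, K)) :
    Prop :=
  [/\ (0 < K)%N /\ (0 < f)%N,
      forall (j : 'I_f) (k : 'I_K) (s : int), P j k = Some s -> s \in S,
      forall k : 'I_K, #|[set j : 'I_f | P j k == None]| = Z,
      forall s : int, s \in S -> exists (j : 'I_f) (k : 'I_K), P j k = Some s
    & forall (j1 j2 : 'I_f) (k1 k2 : 'I_K) (s : int),
        (j1, k1) <> (j2, k2) -> P j1 k1 = Some s -> P j2 k2 = Some s ->
        P j1 k2 = None /\ P j2 k1 = None].

Definition is_regular (K f g : nat) (S : {fset int})
    (P : 'M[option int]_(f, K)) : Prop :=
  forall s : int, s \in S ->
    #|[set c : 'I_f * 'I_K | P c.1 c.2 == Some s]| = g.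

(* The fourth parameter of a PDA given as a number N instead of a set. *)
Definition is_regular_pda_num (g K f Z N : nat) (P : 'M[option int]_(f, K)) :
    Prop :=
  exists S : {fset int},
    [/\ #|` S| = N, is_pda Z S P & is_regular g S P].

(* Stars on [axis], pairwise distinct integers on [side], and the remaining
   cells obtained from [side] by the reflection [refl]. *)
Definition filled_by_reflection (n : nat) (axis side : pred ('I_n * 'I_n))
    (refl : 'I_n * 'I_n -> 'I_n * 'I_n) (P : 'M[option int]_(n, n)) : Prop :=
  [/\ forall c, axis c -> P c.1 c.2 = None,
      forall c, side c -> P c.1 c.2 <> None,
      forall c d, side c -> side d -> P c.1 c.2 = P d.1 d.2 -> c = d
    & forall c, P (refl c).1 (refl c).2 = P c.1 c.2].

(* Which of the two sides is filled first is immaterial, since the array is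
   invariant under the reflection. *)
Definition is_dense_diag (n : nat) (P : 'M[option int]_(n, n)) : Prop :=
  filled_by_reflection
    (fun c => c.1 == c.2) (fun c => (c.1 < c.2)%N) (fun c => (c.2, c.1)) P.

(* The anti-diagonal is j + k = n - 1, and [rev_ord i] is n - 1 - i. *)
Definition is_dense_antidiag (n : nat) (P : 'M[option int]_(n, n)) : Prop :=
  filled_by_reflection
    (fun c => c.1 + c.2 == n.-1)%N (fun c => c.1 + c.2 < n.-1)%N
    (fun c => (rev_ord c.2, rev_ord c.1)) P.

Definition is_dense (n : nat) (P : 'M[option int]_(n, n)) : Prop :=
  is_dense_diag P \/ is_dense_antidiag P.

(* The edge e(s) of the associated graph, given by its set of endpoints: the
   columns in which s occurs.  In a 2-regular PDA there are exactly two. *)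
Definition edge (K f : nat) (P : 'M[option int]_(f, K)) (s : int) : {set 'I_K} :=
  [set k : 'I_K | [exists j : 'I_f, P j k == Some s]].

Definition complete_edges (n : nat) : {set {set 'I_n}} :=
  [set A : {set 'I_n} | #|A| == 2].

(* The associated graph has one edge e(s) for each s in S, so a priori it may
   have parallel edges; being K_n means that every pair of vertices is joined
   by exactly one e(s). *)
Definition assoc_graph_is_complete (K f : nat) (S : {fset int})
    (P : 'M[option int]_(f, K)) : Prop :=
  {in S &, injective (edge P)} /\
  (forall A : {set 'I_K},
     A \in complete_edges K <-> exists2 s : int, s \in S & edge P s = A).

Definition is_one_factor (T : finType) (E M : {set {set T}}) : Prop :=
  [/\ M \subset E, trivIset M & cover M = [set: T]].

Definition is_one_factorization (T I : finType) (E : {set {set T}})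
    (M : I -> {set {set T}}) : Prop :=
  [/\ injective M, partition [set M i | i : I] E
    & forall i : I, is_one_factor E (M i)].

(* The array P_z.  Indices are zero-based, so the integers s_{ij} with
   1 <= i <= z and 1 <= j <= n/2 are the [s i j] with i < z. *)
Definition star_out (n m1 m2 : nat) (P : 'M[option int]_(n, n))
    (s : 'I_m1 -> 'I_m2 -> int) (z : nat) : 'M[option int]_(n, n) :=
  \matrix_(a, b)
    if [exists i : 'I_m1, exists j : 'I_m2,
          (i < z)%N && (P a b == Some (s i j))]
    then None else P a b.

(* Main.v *)
(** Both kinds of dense array become symmetric, with stars exactly on the
    diagonal, after an involution [r] of the rows ([r] is the identity, resp.
    the reversal).  Hence [P (r j) k = Some x] means that e(x) = {j, k}, and the
    graph is K_n.  Starring out the first z one-factors adds to column [b] one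
    star for each of them, at row [r c] with [c] the partner of [b]; the partners
    are distinct because the one-factors are disjoint.  The number of remaining
    integers then follows by counting the integer cells in two ways. *)
Require Import Defs.
From HB Require Import structures.
From mathcomp Require Import all_boot all_order all_algebra.
From mathcomp Require Import finmap zify.

Set Implicit Arguments.
Unset Strict Implicit.
Unset Printing Implicit Defensive.

(** Both sides count the integer cells: by value, each integer filling [g] of them, and by column,
    each column holding [f - Z] of them. *)
Lemma regular_pda_card (K f Z g : nat) (S : {fset int})
    (P : 'M[option int]_(f, K)) :
  is_pda Z S P -> is_regular g S P -> #|` S| * g = K * (f - Z).
Proof.
case=> _ inS stars _ _ reg.
have cell j k : \sum_(x <- S) (P j k == Some x) = (P j k != None).
  case E: (P j k) => [y|]; last by rewrite big1.
  transitivity (count_mem y S).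
    by rewrite -sumn_count sumnE big_map; apply: eq_bigr => x _; rewrite eq_sym.
  by rewrite count_uniq_mem ?fset_uniq // (inS _ _ _ E).
have colsum k : \sum_j (P j k != None) = f - Z.
  have <- : #|~: [set j : 'I_f | P j k == None]| = f - Z.
    by rewrite cardsCs setCK stars card_ord.
  by rewrite -sum1_card [RHS]big_mkcond; apply: eq_bigr => j _; rewrite !inE; case: eqP.
transitivity (\sum_(k < K) \sum_(j < f) \sum_(x <- S) (P j k == Some x)); last first.
  under eq_bigr => k _ do (under eq_bigr => j _ do rewrite cell).
  by under eq_bigr => k _ do rewrite colsum; rewrite sum_nat_const card_ord.
under eq_bigr => k _ do rewrite exchange_big.
rewrite exchange_big /= -sum1_size big_distrl /= big_seq [RHS]big_seq.
apply: eq_bigr => x xS; rewrite mul1n -(reg x xS) exchange_big pair_big /=.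
by rewrite -sum1_card big_mkcond; apply: eq_bigr => c _; rewrite inE; case: eqP.
Qed.

Lemma dense_symmetric (n : nat) (P : 'M[option int]_n) :
  is_dense P -> exists r : 'I_n -> 'I_n,
  [/\ involutive r, forall j k, P (r j) k = P (r k) j
    & forall j k, (P (r j) k == None) = (j == k)].
Proof.
case=> -[axis side _ refl].
- exists id; split=> // [j k|j k]; first exact: (refl (k, j)).
  case: (ltngtP j k) => [lt_jk|lt_kj|/val_inj->].
  + by rewrite -val_eqE /= ltn_eqF //; apply/eqP/(side (j, k)).
  + rewrite -val_eqE /= gtn_eqF //; have /= <- := refl (j, k).
    by apply/eqP/(side (k, j)).
  + by rewrite eqxx; apply/eqP/(axis (k, k))/eqxx.
- have sym j k : P (rev_ord j) k = P (rev_ord k) j.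
    by have /= := refl (rev_ord j, k); rewrite rev_ordK.
  (* Reversing the rows turns the side [c.1 + c.2 < n.-1] into the triangle [k < j]; [sym] then
     covers the other triangle. *)
  have off (j k : 'I_n) : k < j -> P (rev_ord j) k <> None.
    move=> lt_kj; apply: (side (rev_ord j, k)) => /=.
    by have := ltn_ord j; lia.
  exists (@rev_ord n); split=> // [|j k]; first exact: rev_ordK.
  case: (ltngtP j k) => [lt_jk|lt_kj|/val_inj->].
  + by rewrite -val_eqE /= ltn_eqF // sym; apply/eqP/off.
  + by rewrite -val_eqE /= gtn_eqF //; apply/eqP/off.
  + rewrite eqxx; apply/eqP/(axis (rev_ord k, k)) => /=.
    by have := ltn_ord k; apply/implyP; lia.
Qed.

(** The cells [(r j, k)] and [(r k, j)] both hold [x] and differ because [j != k]. By 2-regularity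
    there is no third cell, so these two give all the columns of [x]. *)
Lemma edge_symmetric (n : nat) (S : {fset int}) (P : 'M[option int]_n)
    (r : 'I_n -> 'I_n) :
  involutive r -> (forall j k, P (r j) k = P (r k) j) ->
  (forall j k, (P (r j) k == None) = (j == k)) -> is_regular 2 S P ->
  forall x j k, x \in S -> P (r j) k = Some x -> edge P x = [set j; k].
Proof.
move=> rK sym diag reg x j k xS Pjk.
have neq_jk : j != k by rewrite -diag Pjk.
have cells : [set (r j, k); (r k, j)] = [set c | P c.1 c.2 == Some x].
  apply/eqP; rewrite eqEcard reg // cards2 xpair_eqE negb_and.
  rewrite [k == j]eq_sym neq_jk orbT andbT.
  by apply/subsetP=> c; rewrite !inE => /orP[] /eqP-> /=; rewrite -?[P (r k) j]sym Pjk.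
apply/setP=> b; rewrite !inE; apply/existsP/orP => [[a Pab]|[] /eqP->].
- have : (a, b) \in [set (r j, k); (r k, j)] by rewrite cells inE.
  by rewrite !inE !xpair_eqE => /orP[] /andP[_ ->]; [right|left].
- by exists (r k); rewrite -sym Pjk.
- by exists (r j); rewrite Pjk.
Qed.

Lemma one_factor_partner (T : finType) (M : {set {set T}}) (b : T) :
  is_one_factor [set A : {set T} | #|A| == 2] M ->
  exists2 c, c != b & [set b; c] \in M.
Proof.
case=> /subsetP Mpairs _ Mcov.
have /bigcupP[A AM bA] : b \in cover M by rewrite Mcov inE.
have := Mpairs A AM; rewrite inE => /cards2P[x [y [neq_xy defA]]].
move: bA AM; rewrite defA !inE => /orP[] /eqP-> AM.
- by exists y => //; rewrite eq_sym.
- by exists x => //; rewrite setUC.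
Qed.

Lemma set2_inj (T : finType) (b c d : T) :
  [set b; c] = [set b; d] -> c != b -> c = d.
Proof.
by move=> /setP/(_ c); rewrite !inE eqxx orbT => /esym/orP[->|/eqP].
Qed.

Theorem corollary5 (n : nat) (S : {fset int}) (P : 'M[option int]_(n, n))
  (n_ge2 : (2 <= n)%N) (n_even : ~~ odd n)
  (P_pda : is_pda 1 S P) (P_regular : is_regular 2 S P)
  (S_card : #|` S| = ((n * (n - 1)) %/ 2)%N) (P_dense : is_dense P) :
  assoc_graph_is_complete S P /\
  (forall (M : 'I_(n - 1) -> {set {set 'I_n}})
          (s : 'I_(n - 1) -> 'I_(n %/ 2) -> int),
     is_one_factorization (complete_edges n) M ->
     (forall i j, s i j \in S) ->
     (forall i, M i = [set edge P (s i j) | j : 'I_(n %/ 2)]) ->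
     forall z : nat, (1 <= z <= n - 2)%N ->
     is_regular_pda_num 2 (z + 1) ((n * (n - z - 1)) %/ 2) (star_out P s z)).
Proof.
have [r [rK sym diag]] := dense_symmetric P_dense.
have edgeP := edge_symmetric rK sym diag P_regular.
have [[n_gt0 _] inS _ occurs C3] := P_pda.
have cellP x : x \in S -> exists j k, j != k /\ P (r j) k = Some x.
  move=> /occurs[a [k Pak]]; exists (r a), k.
  by rewrite -diag rK Pak.
have edge_inj : {in S &, injective (edge P)}.
  move=> x y xS yS eq_xy.
  have [j [k [neq_jk Pjk]]] := cellP x xS; have [j' [k' [_ Pjk']]] := cellP y yS.
  have := edgeP y j' k' yS Pjk'; rewrite -eq_xy (edgeP x j k) // => eqE.
  (* Since [j != k], the pair [(j, k)] is [(j', k')] or its swap; by [sym] both lead to the same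
     entry, so [x = y]. *)
  have: (j \in [set j'; k']) && (k \in [set j'; k']) by rewrite -eqE !inE !eqxx orbT.
  rewrite !inE => /andP[/orP[] /eqP Ej /orP[] /eqP Ek]; move: neq_jk Pjk;
    rewrite Ej Ek ?eqxx // => _.
  - by rewrite Pjk' => -[].
  - by rewrite sym Pjk' => -[].
split.
  split=> // A; split.
  - rewrite inE => /cards2P[j [k [neq_jk ->]]].
    case Pjk: (P (r j) k) => [x|]; last by rewrite -diag Pjk in neq_jk.
    by exists x; [apply: inS Pjk | apply: edgeP => //; apply: inS Pjk].
  - case=> x xS <-; have [j [k [neq_jk Pjk]]] := cellP x xS.
    by rewrite (edgeP x j k) // inE cards2 neq_jk.
move=> M s [M_inj Mpart M_factor] sS MS z /andP[_ z_le].
pose removed (x : int) := [exists i : 'I_(n - 1), exists j, (i < z) && (x == s i j)].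
have starE a b : star_out P s z a b =
    if P a b is Some x then if removed x then None else Some x else None.
  by rewrite mxE; case: (P a b) => [x|] //; case: ifP.
have star_Some a b x : star_out P s z a b = Some x <-> P a b = Some x /\ ~~ removed x.
  rewrite starE; case: (P a b) => [y|]; last by split=> // -[].
  by case: ifP => [ry|/negbT nry]; split=> [|[]] // [<-] //; rewrite ry.
pose S' := [fset x in S | ~~ removed x]%fset.
have inS' x : (x \in S') = (x \in S) && ~~ removed x by rewrite !inE.
have column b : #|[set a | star_out P s z a b == None]| = z + 1.
  have /fin_all_exists2[c neq_cb cM] := fun i => one_factor_partner b (M_factor i).
  (* If [c i = c i'], the edge [[set b; c i]] lies in both [M i] and [M i']; distinct blocks of the
     partition are disjoint, so [M i = M i']. *)
  have c_inj : injective c.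
    move=> i i' eq_c; apply: M_inj; apply/eqP/contraT => neqM.
    have /trivIsetP/(_ (M i) (M i')) := partition_trivIset Mpart.
    rewrite !imset_f // neqM => /(_ isT isT isT)/pred0P/(_ [set b; c i]) /=.
    by rewrite cM eq_c cM.
  (* The row [r b] carries the original star of column [b], the rows [r (c i)] with [i < z] the new
     ones. *)
  have -> : [set a | star_out P s z a b == None] =
      r @: (b |: c @: [set i : 'I_(n - 1) | i < z]).
    apply/setP=> a0; rewrite -[a0]rK; move: (r a0) => a.
    rewrite mem_imset ?inE; last exact: inv_inj rK.
    rewrite starE -diag; case Pab: (P (r a) b) => [x|] //=.
    have xS := inS _ _ _ Pab.
    have edge_x : edge P x = [set b; a] by rewrite setUC; apply: edgeP.
    have neq_ab : a != b by rewrite -diag Pab.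
    transitivity (removed x); first by case: (removed x).
    apply/existsP/imsetP => [[i /existsP[j /andP[i_z /eqP def_x]]]|[i]].
    + exists i; first by rewrite inE.
      have xM : [set b; a] \in M i by rewrite -edge_x def_x MS imset_f.
      have [_ Mtriv _] := M_factor i.
      (* Both [[set b; a]] and [[set b; c i]] are the block of [M i] containing [b], hence equal. *)
      apply: (@set2_inj _ b) => //.
      by rewrite -(def_pblock Mtriv xM (set21 b a)) (def_pblock Mtriv (cM i) (set21 _ _)).
    (* Conversely, the edge [[set b; c i]] of [M i] is both e(x) and some e([s i j]), so [edge_inj]
       gives [x = s i j]. *)
    + rewrite inE => i_z def_a; exists i.
      have := cM i; rewrite -def_a -edge_x MS => /imsetP[j _ eq_e].
      by apply/existsP; exists j; rewrite i_z; apply/eqP/edge_inj.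
  rewrite card_imset; last exact: inv_inj rK.
  rewrite cardsU1 card_imset // addnC; congr (_ + _); last first.
    by case: imsetP => [[i _ /esym/eqP]|//]; rewrite (negbTE (neq_cb i)).
  have le_z : z <= n - 1 by apply: leq_trans z_le _; rewrite leq_sub2l.
  have -> : [set i : 'I_(n - 1) | i < z] = widen_ord le_z @: [set: 'I_z].
    apply/setP=> i; rewrite inE; apply/idP/imsetP => [i_z|[k _ ->]]; last exact: ltn_ord k.
    by exists (Ordinal i_z) => //; apply: val_inj.
  rewrite card_imset ?cardsT ?card_ord // => i j eq_ij.
  by apply: val_inj; have := congr1 val eq_ij.
have pda' : is_pda (z + 1) S' (star_out P s z).
  split=> // [j k x /star_Some[/inS xS nx]|x|j1 j2 k1 k2 x neq].
  - by rewrite inS' xS.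
  - by rewrite inS' => /andP[/occurs[j [k Pjk]] nx]; exists j, k; apply/star_Some.
  - move=> /star_Some[P1 _] /star_Some[P2 _].
    (* Stars of [P] remain stars, so the Blackburn property is inherited. *)
    by have [] := C3 _ _ _ _ _ neq P1 P2; rewrite !starE => -> ->.
(* An integer is starred out at all of its cells or at none, so each survivor keeps both
   occurrences. *)
have reg' : is_regular 2 S' (star_out P s z).
  move=> x; rewrite inS' => /andP[xS nx]; rewrite -[RHS](P_regular x xS).
  congr #|pred_of_set _|; apply/setP=> c; rewrite !inE.
  by apply/eqP/eqP => [/star_Some[]|Pc] //; apply/star_Some.
exists S'; split=> //.
(* The double count gives twice the size of [S'] as [n * (n - (z + 1))], so the division by 2 is
   exact. *)
by rewrite -subnDA -(regular_pda_card pda' reg') mulnK.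
Qed.
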